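(* For any H-Qbricks program $p$ that is well formed relative to the HPS $h$, and any history $\eta$, $$\|\xi(h)(\eta)\|^2 = \sum_{\eta'\ge\eta}\|\xi([\![p]\!](h))(\eta')\|^2.$$
   Context: HPS: $h=\langle P,o,s\rangle_{su}$ with $su$ a finite set of Boolean path variables; $o_{Qu}$ a finite map from quantum addresses to Boolean polynomials in the (input and) path variables; $o_{Cl}$ a stack of maps from classical addresses to such polynomials recording classical values at successive time steps (top = current); $P$ a dyadic-coefficient polynomial; $s$ a real scalar expression. A history $\eta$ is a full instantiation of a classical stack; its length $|\eta|$ is the stack height. $\eta\le\eta'$ (temporal order) means $|\eta|\le|\eta'|$ and the $|\eta|$ oldest entries of $\eta'$ coincide with $\eta$. $\xi(h)(\eta)=\sum_{\vec y\in\{0,1\}^{su},o_{Cl}(\vec y)=\eta}s(\vec y)e^{2\pi iP(\vec y)}|o_{Qu}(\vec y)\rangle$. $h_1\boxplus h_2$ is the HPS on support $su_1\cup su_2\cup\{y_f\}$ ($y_f$ fresh) equal to $h_1$ (scalar times $\prod_{y\in su_2\setminus su_1}y$) on $y_f=0$ and to $h_2$ (scalar times $\prod_{y\in su_1\setminus su_2}y$) on $y_f=1$. Programs: Skip; Init $q$; Apply $G(q)$, $G\in\{H,X\}\cup\{Z_k\}_{k\in\mathbb N}$; Measure$(q,c)$; $c_1:=f(c_2)$; $p;p'$; For $x=i..j$ do $p$ (constant bounds); If $b$ then $p$ else $p'$ ($b$ over classical registers, or $b$ involving quantum registers with $p,p'$ unitary programs whose registers are disjoint from those of $b$). Well formed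 relative to $h$: gates act only on registers allocated (present in the current HPS), Init is applied only to registers not already allocated, and both branches of an If have the same allocated registers. Semantics (single qubit $q$; $\lceil q\rceil$ = current contents): Skip identity; $[\![\mathrm{Init}\,q]\!]h=h[q\leftarrow0]$; $[\![H(q)]\!]h$: add fresh $y$ to support, scalar times $1/\sqrt2$, phase plus $y\lceil q\rceil/2$, $q$ set to $y$; $[\![X(q)]\!]h=h[q\leftarrow1\oplus\lceil q\rceil]$; $[\![Z_k(q)]\!]h$: phase plus $\lceil q\rceil/2^k$; $[\![\mathrm{Measure}(q,c)]\!]h$ pushes onto $o_{Cl}$ a copy of the top entry with $c$ holding $\lceil q\rceil$; $[\![c_1:=f(c_2)]\!]h$ pushes a copy with $c_1$ holding $f(\lceil c_2\rceil)$; $[\![p;p']\!]=[\![p']\!]\circ[\![p]\!]$; For unfolds; $[\![\mathrm{If}\,b\,\mathrm{then}\,p\,\mathrm{else}\,p']\!]h=[\![p]\!](b\cdot h)\boxplus[\![p']\!]((1-b)\cdot h)$, $b\cdot h$ multiplying the scalar by $b$.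
   Formalization: The history η is taken to have length equal to the height of h's classical stack (the identity fails for other lengths), and when the two branches of an If leave stacks of different heights, ⊞ pads the shorter one by repeating its top entry. *)

(* Defs.v *)
From HB Require Import structures.
From mathcomp Require Import all_boot all_order all_algebra.
From mathcomp Require Import reals trigo.
From mathcomp Require Import complex.

Set Implicit Arguments.
Unset Strict Implicit.
Unset Printing Implicit Defensive.

Import Order.TTheory GRing.Theory Num.Theory.
Local Open Scope ring_scope.

(* Valuations of input variables and of path variables (both indexed by nat). *)
Definition ival := nat -> bool.
Definition pval := nat -> bool.
(* Boolean polynomials in the input and path variables (shallow embedding:
   every Boolean function is a Boolean polynomial). *)
Definition bpoly := ival -> pval -> bool.

Section HQbricks.
Variables (R : realType) (QA CA : finType).
(* QA : quantum addresses, CA : classical addresses (arbitrary finite types). *)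

Record hps := HPS {
  supp  : seq nat;                 (* su : the path variables *)
  oQu   : QA -> option bpoly;      (* finite map; None = not allocated *)
  oCl   : seq (CA -> bpoly);       (* classical stack, OLDEST FIRST, top = last *)
  phase : ival -> pval -> R;
  scal  : ival -> pval -> R
}.

Definition hps_wf (h : hps) : Prop :=
  forall (x : ival) (y y' : pval), {in supp h, y =1 y'} ->
  [/\ forall q p, oQu h q = Some p -> p x y = p x y',
      forall i c, (i < size (oCl h))%N ->
        nth (fun _ _ _ => false) (oCl h) i c x y =
        nth (fun _ _ _ => false) (oCl h) i c x y',
      phase h x y = phase h x y' &
      scal h x y = scal h x y'].

Definition b2R (b : bool) : R := (b : nat)%:R.

Definition topCl (st : seq (CA -> bpoly)) : CA -> bpoly :=
  last (fun _ _ _ => false) st.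

Definition cur (h : hps) (q : QA) : bpoly :=
  match oQu h q with Some p => p | None => fun _ _ => false end.

Definition fresh (s : seq nat) : nat := (\max_(v <- s) v).+1.

Definition upd_val (y : pval) (v : nat) (b : bool) : pval :=
  fun n => if n == v then b else y n.

Fixpoint vals (s : seq nat) : seq pval :=
  match s with
  | [::] => [:: fun _ => false]
  | v :: s' => [seq upd_val y v b | b <- [:: false; true], y <- vals s']
  end.
Definition assignments (su : seq nat) := vals (undup su).

Definition clentry := {ffun CA -> bool}.
Definition history := seq clentry.           (* oldest entry first *)
Definition ket := {ffun QA -> option bool}.  (* basis state of allocated regs *)

Definition inst_cl (h : hps) (x : ival) (y : pval) : history :=
  [seq [ffun c => m c x y] | m <- oCl h].
Definition inst_qu (h : hps) (x : ival) (y : pval) : ket :=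
  [ffun q => omap (fun p => p x y) (oQu h q)].

Definition expi2pi (t : R) : R[i] :=
  Complex (cos (2 * pi * t)) (sin (2 * pi * t)).

(* coordinate of xi(h)(eta) on the basis ket |k> (inputs fixed to x) *)
Definition amp (h : hps) (x : ival) (eta : history) (k : ket) : R[i] :=
  \sum_(y <- assignments (supp h) |
        (inst_cl h x y == eta) && (inst_qu h x y == k))
     Complex (scal h x y) 0 * expi2pi (phase h x y).

Definition normsq (z : R[i]) : R := let: Complex a b := z in a ^+ 2 + b ^+ 2.

Definition xi_normsq (h : hps) (x : ival) (eta : history) : R :=
  \sum_(k : ket) normsq (amp h x eta k).

Inductive gate := GH | GX | GZ of nat.

Inductive bexp :=
  | BConst of bool
  | BCl of CA
  | BQu of QA
  | BNeg of bexp
  | BAnd of bexp & bexp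
  | BXor of bexp & bexp.

Inductive prog :=
  | Skip
  | Init of QA
  | Apply of gate & QA
  | Measure of QA & CA
  | Assign of CA & (bool -> bool) & CA
  | PSeq of prog & prog
  | For of nat & nat & (nat -> prog)
  | If of bexp & prog & prog.

Definition for_range (i j : nat) : seq nat := iota i (j.+1 - i).

Fixpoint qregs_b (b : bexp) : seq QA :=
  match b with
  | BConst _ | BCl _ => [::]
  | BQu q => [:: q]
  | BNeg b1 => qregs_b b1
  | BAnd b1 b2 | BXor b1 b2 => qregs_b b1 ++ qregs_b b2
  end.

Fixpoint cregs_b (b : bexp) : seq CA :=
  match b with
  | BConst _ | BQu _ => [::]
  | BCl c => [:: c]
  | BNeg b1 => cregs_b b1
  | BAnd b1 b2 | BXor b1 b2 => cregs_b b1 ++ cregs_b b2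
  end.

Fixpoint qregs (p : prog) : seq QA :=
  match p with
  | Skip | Assign _ _ _ => [::]
  | Init q | Apply _ q | Measure q _ => [:: q]
  | PSeq p1 p2 => qregs p1 ++ qregs p2
  | For i j body => flatten [seq qregs (body k) | k <- for_range i j]
  | If b p1 p2 => qregs_b b ++ qregs p1 ++ qregs p2
  end.

Fixpoint cregs (p : prog) : seq CA :=
  match p with
  | Skip | Init _ | Apply _ _ => [::]
  | Measure _ c => [:: c]
  | Assign c1 _ c2 => [:: c1; c2]
  | PSeq p1 p2 => cregs p1 ++ cregs p2
  | For i j body => flatten [seq cregs (body k) | k <- for_range i j]
  | If b p1 p2 => cregs_b b ++ cregs p1 ++ cregs p2
  end.

Fixpoint unitary (p : prog) : bool :=
  match p with
  | Skip | Apply _ _ => true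
  | Init _ | Measure _ _ | Assign _ _ _ => false
  | PSeq p1 p2 => unitary p1 && unitary p2
  | For i j body => all (fun k => unitary (body k)) (for_range i j)
  | If _ p1 p2 => unitary p1 && unitary p2
  end.

Fixpoint beval (b : bexp) (h : hps) : bpoly :=
  match b with
  | BConst c => fun _ _ => c
  | BCl c => topCl (oCl h) c
  | BQu q => cur h q
  | BNeg b1 => fun x y => ~~ beval b1 h x y
  | BAnd b1 b2 => fun x y => beval b1 h x y && beval b2 h x y
  | BXor b1 b2 => fun x y => beval b1 h x y (+) beval b2 h x y
  end.

Definition set_qu (h : hps) (q : QA) (p : bpoly) : hps :=
  HPS (supp h) (fun q' => if q' == q then Some p else oQu h q')
      (oCl h) (phase h) (scal h).

Definition push (h : hps) (m : CA -> bpoly) : hps :=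
  HPS (supp h) (oQu h) (rcons (oCl h) m) (phase h) (scal h).

Definition sem_gate (g : gate) (q : QA) (h : hps) : hps :=
  match g with
  | GH =>
      let v := fresh (supp h) in
      HPS (v :: supp h)
          (fun q' => if q' == q then Some (fun _ y => y v) else oQu h q')
          (oCl h)
          (fun x y => phase h x y + b2R (y v && cur h q x y) / 2)
          (fun x y => scal h x y / Num.sqrt 2)
  | GX => set_qu h q (fun x y => ~~ cur h q x y)
  | GZ k =>
      HPS (supp h) (oQu h) (oCl h)
          (fun x y => phase h x y + b2R (cur h q x y) / 2 ^+ k)
          (scal h)
  end.

Definition bmul (b : bpoly) (h : hps) : hps :=
  HPS (supp h) (oQu h) (oCl h) (phase h) (fun x y => b2R (b x y) * scal h x y).
Definition bmulC (b : bpoly) (h : hps) : hps :=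
  HPS (supp h) (oQu h) (oCl h) (phase h)
      (fun x y => (1 - b2R (b x y)) * scal h x y).

Definition pad (n : nat) (st : seq (CA -> bpoly)) : seq (CA -> bpoly) :=
  st ++ nseq (n - size st) (topCl st).

Definition boxplus (h1 h2 : hps) : hps :=
  let su := undup (supp h1 ++ supp h2) in
  let v := fresh su in
  let n := maxn (size (oCl h1)) (size (oCl h2)) in
  HPS (v :: su)
      (fun q => match oQu h1 q, oQu h2 q with
                | Some a, Some b => Some (fun x y => if y v then b x y else a x y)
                | o1, _ => o1
                end)
      [seq (fun c x y => if y v then m.2 c x y else m.1 c x y)
         | m <- zip (pad n (oCl h1)) (pad n (oCl h2))]
      (fun x y => if y v then phase h2 x y else phase h1 x y)
      (fun x y => if y v
         then scal h2 x y * \prod_(w <- undup (supp h1) | w \notin supp h2) b2R (y w)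
         else scal h1 x y * \prod_(w <- undup (supp h2) | w \notin supp h1) b2R (y w)).

Fixpoint sem (p : prog) (h : hps) : hps :=
  match p with
  | Skip => h
  | Init q => set_qu h q (fun _ _ => false)
  | Apply g q => sem_gate g q h
  | Measure q c =>
      push h (fun c' => if c' == c then cur h q else topCl (oCl h) c')
  | Assign c1 f c2 =>
      push h (fun c' => if c' == c1 then (fun x y => f (topCl (oCl h) c2 x y))
                        else topCl (oCl h) c')
  | PSeq p1 p2 => sem p2 (sem p1 h)
  | For i j body => foldl (fun h' k => sem (body k) h') h (for_range i j)
  | If b p1 p2 =>
      boxplus (sem p1 (bmul (beval b h) h)) (sem p2 (bmulC (beval b h) h))
  end.

Fixpoint wf (p : prog) (h : hps) : Prop :=
  match p with
  | Skip | Measure _ _ | Assign _ _ _ => True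
  | Init q => oQu h q = None
  | Apply _ q => oQu h q <> None
  | PSeq p1 p2 => wf p1 h /\ wf p2 (sem p1 h)
  | For i j body =>
      (fix go (ks : seq nat) (h' : hps) : Prop :=
         match ks with
         | [::] => True
         | k :: ks' => wf (body k) h' /\ go ks' (sem (body k) h')
         end) (for_range i j) h
  | If b p1 p2 =>
      [/\
          qregs_b b = [::] \/
          [/\ unitary p1, unitary p2,
              all (fun q => q \notin qregs_b b) (qregs p1 ++ qregs p2) &
              all (fun c => c \notin cregs_b b) (cregs p1 ++ cregs p2)],
          wf p1 (bmul (beval b h) h),
          wf p2 (bmulC (beval b h) h) &
          forall q, isSome (oQu (sem p1 (bmul (beval b h) h)) q) =
                    isSome (oQu (sem p2 (bmulC (beval b h) h)) q)]
  end.

End HQbricks.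

(* Main.v *)
Require Import Defs.
From HB Require Import structures.
From mathcomp Require Import all_boot all_order all_algebra.
From mathcomp Require Import boolp reals trigo.
From mathcomp Require Import complex.
From mathcomp Require Import ring.

Set Implicit Arguments.
Unset Strict Implicit.
Unset Printing Implicit Defensive.

Import Order.TTheory GRing.Theory Num.Theory.
Local Open Scope ring_scope.

(** For a fixed input, the square norm is a double sum over pairs of paths (the
    Gram kernel) that have the same classical history and the same ket.  For
    every instruction except the Hadamard gate and the conditional this
    relation between paths, and the product of the two weights, do not change.
    For the Hadamard gate the sum over the new path variable gives back the
    condition that the two old values of the qubit agree.  In a conditional
    the guard is a function of the history and of the registers that the
    branches leave alone, and a path of nonzero weight selects the branch
    chosen by the guard; hence the cross terms vanish. *)

(** * Sums over path assignments *)

Lemma fresh_notin (s : seq nat) : fresh s \notin s.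
Proof.
apply/negP => hs; have /(_ isT) := @leq_bigmax_seq _ s xpredT id (fresh s) hs.
by rewrite /fresh ltnn.
Qed.

Lemma upd_val_same (y : pval) v b : upd_val y v b v = b.
Proof. by rewrite /upd_val eqxx. Qed.

Lemma upd_val_agree (s : seq nat) (y : pval) v b :
  v \notin s -> {in s, upd_val y v b =1 y}.
Proof. by move=> vs w ws; rewrite /upd_val; case: eqP vs => // <-; rewrite ws. Qed.

Lemma upd_valC (y : pval) u v a b : u != v ->
  upd_val (upd_val y u a) v b = upd_val (upd_val y v b) u a.
Proof.
move=> uv; apply: funext => n; rewrite /upd_val.
by case: (eqVneq n v) => // ->; rewrite eq_sym (negbTE uv).
Qed.

Section SumVals.
Variable V : comNzRingType.
Implicit Types F : pval -> V.

Lemma sum_vals_cons F v s :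
  \sum_(y <- vals (v :: s)) F y =
  \sum_(y <- vals s) (F (upd_val y v false) + F (upd_val y v true)).
Proof. by rewrite /= cats0 big_cat !big_map big_split. Qed.

Lemma sum_vals_move F v s t : v \notin s ->
  \sum_(y <- vals (s ++ v :: t)) F y = \sum_(y <- vals (v :: s ++ t)) F y.
Proof.
elim: s F => [|u s IH] F; first by [].
rewrite inE negb_or => /andP[vu vs].
rewrite !cat_cons sum_vals_cons IH // !sum_vals_cons; apply: eq_bigr => y _.
by rewrite !(@upd_valC y v u) //; ring.
Qed.

(** A common support restricted to one branch is the support of that branch only up to order; this
    lemma absorbs the reordering. *)
Lemma sum_vals_perm F s t : uniq s -> perm_eq s t ->
  \sum_(y <- vals s) F y = \sum_(y <- vals t) F y.
Proof.
elim: s F t => [|v s IH] F t; first by move=> _; rewrite perm_sym => /perm_nilP ->.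
rewrite cons_uniq => /andP[vs us] st.
have vt : v \in t by rewrite -(perm_mem st) mem_head.
have ut : uniq t by rewrite -(perm_uniq st) cons_uniq vs us.
case/splitPr: vt st ut => t1 t2 st; rewrite cat_uniq /= => /and3P[_ /norP[vt1 _] _].
rewrite sum_vals_move // !sum_vals_cons; apply: IH => //.
by rewrite -(perm_cons v) (perm_trans st) // -cat1s perm_catCA.
Qed.

(** The product kills every assignment that is false at some variable of [s] outside [s1]. Since [F]
    does not see those variables, pinning them to true leaves exactly one copy of each assignment on
    [s1]. *)
Lemma sum_vals_pinned (s1 s : seq nat) F : uniq s ->
  (forall y y' : pval, {in s1, y =1 y'} -> F y = F y') ->
  \sum_(y <- vals s) (F y * \prod_(w <- s | w \notin s1) (y w : nat)%:R) =
  \sum_(y <- vals [seq w <- s | w \in s1]) F y.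
Proof.
elim: s F => [|v s IH] F us loc.
  by rewrite /= !big_seq1 big_nil mulr1.
move: us; rewrite cons_uniq => /andP[vs us]; rewrite sum_vals_cons.
have prodE y b : \prod_(w <- s | w \notin s1) (upd_val y v b w : nat)%:R
    = \prod_(w <- s | w \notin s1) (y w : nat)%:R :> V.
  by rewrite big_seq_cond [RHS]big_seq_cond; apply: eq_bigr => w /andP[ws _]; rewrite (upd_val_agree _ _ vs ws).
rewrite /=; under eq_bigr => y _ do rewrite !big_cons !prodE !upd_val_same.
case: ifPn => vs1 /=.
  under eq_bigr => y _ do rewrite -mulrDl.
  rewrite IH // ?sum_vals_cons // => y y' yy'.
  by congr (_ + _); apply: loc => w ws; rewrite /upd_val; case: ifP => // _; apply: yy'.
rewrite -IH //; apply: eq_bigr => y _.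
by rewrite !(loc (upd_val y v _) y) ?mul0r ?mulr0 ?mul1r ?add0r //; apply: upd_val_agree.
Qed.

End SumVals.

(** * Semantics along a single path *)

Section Paths.
Variables (R : realType) (QA CA : finType).
Implicit Types (h : hps R QA CA) (p : prog QA CA) (b : bexp QA CA).
Implicit Types (x : ival) (y : pval) (s : history CA).

(** Well-formedness restated on the instantiated ket and history, the form that passes through
    [boxplus] and allows a fresh variable to be altered. *)
Definition hps_local h : Prop :=
  forall x y y', {in supp h, y =1 y'} ->
  [/\ inst_qu h x y = inst_qu h x y', inst_cl h x y = inst_cl h x y',
      phase h x y = phase h x y' & scal h x y = scal h x y'].

Lemma hps_wf_local h : hps_wf h -> hps_local h.
Proof.
move=> wfh x y y' /(wfh x) [hq hc hp hs]; split=> //.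
  by apply/ffunP => q; rewrite !ffunE; case E: (oQu h q) => [a|] //=; rewrite (hq _ _ E).
apply: (@eq_from_nth _ [ffun=> false]); rewrite !size_map // => i ih.
rewrite !(nth_map (fun _ _ _ => false)) //.
by apply/ffunP => c; rewrite !ffunE hc.
Qed.

(** The all-false default matches that of [topCl], so [topClE] also covers the empty stack. *)
Definition top_entry s : clentry CA := last [ffun=> false] s.

Definition ket_bit (k : ket QA) (q : QA) : bool := odflt false (k q).

Lemma topClE h c x y : topCl (oCl h) c x y = top_entry (inst_cl h x y) c.
Proof.
pose f (m : CA -> bpoly) : clentry CA := [ffun c => m c x y].
by rewrite /topCl /top_entry (last_map f (oCl h) (fun _ _ _ => false)) ffunE.
Qed.

Lemma curE h q x y : cur h q x y = ket_bit (inst_qu h x y) q.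
Proof. by rewrite /cur /ket_bit ffunE; case: (oQu h q). Qed.

Lemma inst_qu_none h q x y : oQu h q = None -> inst_qu h x y q = None.
Proof. by rewrite ffunE => ->. Qed.

Lemma inst_qu_some h q x y : oQu h q <> None ->
  inst_qu h x y q = Some (ket_bit (inst_qu h x y) q).
Proof. by rewrite /ket_bit ffunE; case: (oQu h q). Qed.

(** Reads the guard off the outcome of a path instead of the path itself, so that paths with equal
    outcomes visibly agree on it. *)
Fixpoint bval (b : bexp QA CA) (m : clentry CA) (k : ket QA) : bool :=
  match b with
  | BConst c => c
  | BCl c => m c
  | BQu q => ket_bit k q
  | BNeg b1 => ~~ bval b1 m k
  | BAnd b1 b2 => bval b1 m k && bval b2 m k
  | BXor b1 b2 => bval b1 m k (+) bval b2 m k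
  end.

Lemma bevalE b h x y :
  beval b h x y = bval b (top_entry (inst_cl h x y)) (inst_qu h x y).
Proof.
elim: b => //= [c|q|b1 ->|b1 -> b2 ->|b1 -> b2 ->] //; [exact: topClE|exact: curE].
Qed.

Lemma eq_bval b m (k k' : ket QA) :
  {in qregs_b b, k =1 k'} -> bval b m k = bval b m k'.
Proof.
elim: b => //= [q|b1 IH|b1 IH1 b2 IH2|b1 IH1 b2 IH2] kk'.
- by rewrite /ket_bit kk' ?mem_head.
- by rewrite IH.
- by rewrite IH1 ?IH2 // => q qb; apply: kk'; rewrite mem_cat qb ?orbT.
- by rewrite IH1 ?IH2 // => q qb; apply: kk'; rewrite mem_cat qb ?orbT.
Qed.

(** * Histories and kets after each operation *)

Lemma size_inst_cl h x y : size (inst_cl h x y) = size (oCl h).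
Proof. by rewrite size_map. Qed.

Lemma inst_cl_push h m x y :
  inst_cl (push h m) x y = rcons (inst_cl h x y) [ffun c => m c x y].
Proof. by rewrite /inst_cl map_rcons. Qed.

Lemma inst_qu_set h q a x y : inst_qu (set_qu h q a) x y =
  [ffun q' => if q' == q then Some (a x y) else inst_qu h x y q'].
Proof. by apply/ffunP => q'; rewrite !ffunE /=; case: eqP. Qed.

Lemma inst_qu_hadamard h q x y : inst_qu (sem_gate GH q h) x y =
  [ffun q' => if q' == q then Some (y (fresh (supp h))) else inst_qu h x y q'].
Proof. by apply/ffunP => q'; rewrite !ffunE /=; case: eqP. Qed.

Definition pad_history (n : nat) s : history CA :=
  s ++ nseq (n - size s) (top_entry s).

Definition branch_var (h1 h2 : hps R QA CA) : nat :=
  fresh (undup (supp h1 ++ supp h2)).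

Lemma size_pad n (st : seq (CA -> bpoly)) : (size st <= n)%N -> size (pad n st) = n.
Proof. by move=> sn; rewrite size_cat size_nseq subnKC. Qed.

Lemma inst_cl_boxplus h1 h2 x y : inst_cl (boxplus h1 h2) x y =
  pad_history (maxn (size (oCl h1)) (size (oCl h2)))
    (if y (branch_var h1 h2) then inst_cl h2 x y else inst_cl h1 x y).
Proof.
set n := maxn _ _.
have s1 : size (pad n (oCl h1)) = n by rewrite size_pad // leq_maxl.
have s2 : size (pad n (oCl h2)) = n by rewrite size_pad // leq_maxr.
have padE h : [seq [ffun c => m c x y] | m <- pad n (oCl h)]
    = pad_history n (inst_cl h x y).
  rewrite map_cat map_nseq /pad_history size_inst_cl; congr (_ ++ nseq _ _).
  by apply/ffunP => c; rewrite ffunE topClE.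
rewrite /inst_cl /= -/n -map_comp -/(branch_var h1 h2).
case: (boolP (y (branch_var h1 h2))) => yv.
  (* Both padded stacks have height [n], so zipping them truncates neither. *)
  rewrite -padE -{2}(@unzip2_zip _ _ (pad n (oCl h1)) (pad n (oCl h2))) ?s1 ?s2 //.
  by rewrite -map_comp; apply: eq_map => m /=; apply/ffunP => c; rewrite !ffunE yv.
rewrite -padE -{2}(@unzip1_zip _ _ (pad n (oCl h1)) (pad n (oCl h2))) ?s1 ?s2 //.
rewrite -map_comp; apply: eq_map => m /=; apply/ffunP => c.
by rewrite !ffunE (negbTE yv).
Qed.

Lemma inst_qu_boxplus h1 h2 x y q : inst_qu (boxplus h1 h2) x y q =
  match inst_qu h1 x y q, inst_qu h2 x y q with
  | Some b1, Some b2 => Some (if y (branch_var h1 h2) then b2 else b1)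
  | o, _ => o
  end.
Proof.
by rewrite !ffunE /=; case: (oQu h1 q) => [a1|]; case: (oQu h2 q) => [a2|].
Qed.

(** * Preservation of locality *)

Lemma hps_local_bmul b h : hps_local h -> hps_local (bmul (beval b h) h).
Proof.
move=> lh x y y' yy'; have [qE cE pE sE] := lh x _ _ yy'; split=> //=.
by rewrite sE !bevalE qE cE.
Qed.

Lemma hps_local_bmulC b h : hps_local h -> hps_local (bmulC (beval b h) h).
Proof.
move=> lh x y y' yy'; have [qE cE pE sE] := lh x _ _ yy'; split=> //=.
by rewrite sE !bevalE qE cE.
Qed.

Lemma hps_local_gate g q h : hps_local h -> hps_local (sem_gate g q h).
Proof.
case: g => [||k] lh x y y' yy'.
- have yy'h : {in supp h, y =1 y'} by move=> w wh; apply: yy'; rewrite inE wh orbT.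
  have [qE cE pE sE] := lh x _ _ yy'h.
  have vE : y (fresh (supp h)) = y' (fresh (supp h)) by apply: yy'; rewrite mem_head.
  by split; rewrite ?inst_qu_hadamard //= ?qE ?vE ?pE ?sE // !curE qE.
- have [qE cE pE sE] := lh x _ _ yy'.
  by split => //; rewrite !inst_qu_set qE !curE qE.
- have [qE cE pE sE] := lh x _ _ yy'.
  by split => //=; rewrite pE !curE qE.
Qed.

Lemma hps_local_boxplus h1 h2 :
  hps_local h1 -> hps_local h2 -> hps_local (boxplus h1 h2).
Proof.
move=> l1 l2 x y y' yy'.
have in1 : {in supp h1, y =1 y'}.
  by move=> w w1; apply: yy'; rewrite inE mem_undup mem_cat w1 orbT.
have in2 : {in supp h2, y =1 y'}.
  by move=> w w2; apply: yy'; rewrite inE mem_undup mem_cat w2 !orbT.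
have vE : y (branch_var h1 h2) = y' (branch_var h1 h2) by apply: yy'; rewrite mem_head.
have [q1 c1 p1 s1] := l1 x _ _ in1; have [q2 c2 p2 s2] := l2 x _ _ in2.
split.
- by apply/ffunP => q; rewrite !inst_qu_boxplus q1 q2 vE.
- by rewrite !inst_cl_boxplus vE c1 c2.
- by rewrite /= -/(branch_var h1 h2) vE p1 p2.
- rewrite /= -/(branch_var h1 h2) vE s1 s2; case: ifP => _; congr (_ * _).
    rewrite big_seq_cond [RHS]big_seq_cond; apply: eq_bigr => w.
    by rewrite mem_undup => /andP[w1 _]; rewrite in1.
  rewrite big_seq_cond [RHS]big_seq_cond; apply: eq_bigr => w.
    by rewrite mem_undup => /andP[w2 _]; rewrite in2.
Qed.

Lemma hps_local_push h m : hps_local h ->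
  (forall x y y', {in supp h, y =1 y'} -> forall c, m c x y = m c x y') ->
  hps_local (push h m).
Proof.
move=> lh lm x y y' yy'; have [qE cE pE sE] := lh x _ _ yy'; split=> //.
rewrite !inst_cl_push cE; congr rcons.
by apply/ffunP => c; rewrite !ffunE (lm _ _ _ yy' c).
Qed.

Lemma hps_local_sem p h : hps_local h -> hps_local (sem p h).
Proof.
elim: p h => [|q|g q|q c|c1 f c2|p1 IH1 p2 IH2|i j body IH|b p1 IH1 p2 IH2] h lh //=.
- move=> x y y' yy'; have [qE cE pE sE] := lh x _ _ yy'.
  by split=> //; rewrite !inst_qu_set qE.
- exact: hps_local_gate.
- apply: hps_local_push => // x y y' /(lh x) [qE cE _ _] c'.
  by case: ifP => _; rewrite ?curE ?topClE ?qE ?cE.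
- apply: hps_local_push => // x y y' /(lh x) [qE cE _ _] c'.
  by case: ifP => _; rewrite !topClE cE.
- by apply/IH2/IH1.
- by elim: (for_range i j) h lh => //= k ks IHks h lh; apply/IHks/IH.
- by apply: hps_local_boxplus; [apply/IH1/hps_local_bmul|apply/IH2/hps_local_bmulC].
Qed.

(** Instructions act on the scalar of a path by multiplication only; a path discarded by a guard
    therefore stays discarded throughout the branch. *)
Lemma scal_sem_eq0 p h x y : scal h x y = 0 -> scal (sem p h) x y = 0.
Proof.
elim: p h => [|q|g q|q c|c1 f c2|p1 IH1 p2 IH2|i j body IH|b p1 IH1 p2 IH2] h s0 //=.
- by case: g => [||k] //=; rewrite s0 mul0r.
- by apply/IH2/IH1.
- by elim: (for_range i j) h s0 => //= k ks IHks h s0; apply/IHks/IH.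
- by rewrite IH1 ?IH2 /= ?s0 ?mulr0 // !mul0r if_same.
Qed.

Lemma inst_qu_sem p h x y q : q \notin qregs p ->
  inst_qu (sem p h) x y q = inst_qu h x y q.
Proof.
elim: p h => [|r|g r|r c|c1 f c2|p1 IH1 p2 IH2|i j body IH|b p1 IH1 p2 IH2] h //=.
- by rewrite inE inst_qu_set ffunE => /negbTE ->.
- rewrite inE => /negbTE qr; case: g => [||k] //.
    by rewrite inst_qu_hadamard ffunE qr.
  by rewrite inst_qu_set ffunE qr.
- by rewrite mem_cat negb_or => /andP[q1 q2]; rewrite IH2 // IH1.
- elim: (for_range i j) h => //= k ks IHks h.
  by rewrite mem_cat negb_or => /andP[q1 q2]; rewrite IHks // IH.
- rewrite !mem_cat !negb_or => /and3P[_ q1 q2].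
  rewrite inst_qu_boxplus IH1 // IH2 //= -[inst_qu (bmul _ _) _ _]/(inst_qu h x y).
  rewrite -[inst_qu (bmulC _ _) _ _]/(inst_qu h x y).
  (* Both branches keep the old entry of [q], so the value of the branch variable is immaterial. *)
  by case: (inst_qu h x y q) => // c; rewrite if_same.
Qed.

Lemma inst_cl_sem_prefix p h x y : prefix (inst_cl h x y) (inst_cl (sem p h) x y).
Proof.
elim: p h => [|q|g q|q c|c1 f c2|p1 IH1 p2 IH2|i j body IH|b p1 IH1 p2 IH2] h /=;
  rewrite ?prefix_refl ?inst_cl_push ?prefix_rcons //.
- by case: g => *; exact: prefix_refl.
- exact: prefix_trans (IH1 h) (IH2 _).
- elim: (for_range i j) h => [|k ks IHks] h /=; first exact: prefix_refl.
  exact: prefix_trans (IH k h) (IHks _).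
- rewrite inst_cl_boxplus; apply: prefix_catl.
  by case: (y _); [exact: (IH2 (bmulC _ _))|exact: (IH1 (bmul _ _))].
Qed.

Lemma size_oCl_sem p h : (size (oCl h) <= size (oCl (sem p h)))%N.
Proof.
(* The stack height is the same along every path, so any input and path can serve to compare
   heights. *)
by have /size_prefix := inst_cl_sem_prefix p h (fun=> false) (fun=> false); rewrite !size_inst_cl.
Qed.

End Paths.

(** * The Gram kernel *)

Section Gram.
Variables (R : realType) (QA CA : finType).
Implicit Types (h : hps R QA CA) (p : prog QA CA) (b : bexp QA CA).
Implicit Types (x : ival) (y : pval) (eta : history CA).

Definition same_outcome h x y y' : bool :=
  (inst_cl h x y == inst_cl h x y') && (inst_qu h x y == inst_qu h x y').

(** Real part of one path weight times the conjugate of the other; imaginary parts cancel in a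
    symmetric double sum. *)
Definition interference h x y y' : R :=
  scal h x y * scal h x y' * cos (2 * pi * phase h x y - 2 * pi * phase h x y').

(** Testing a prefix rather than equality lets one kernel serve both sides of the theorem: at full
    height the prefix is the whole history, at greater height it collects all extensions of
    [eta]. *)
Definition gram_kernel h x eta y y' : R :=
  if same_outcome h x y y' && prefix eta (inst_cl h x y)
  then interference h x y y' else 0.

Definition gram h x eta : R :=
  \sum_(y <- assignments (supp h)) \sum_(y' <- assignments (supp h))
    gram_kernel h x eta y y'.

Lemma normsq_sum (I : Type) (r : seq I) (P : pred I) (s f : I -> R) :
  normsq (\sum_(i <- r | P i) Complex (s i) 0 * expi2pi (f i)) =
  \sum_(i <- r | P i) \sum_(j <- r | P j)
     s i * s j * cos (2 * pi * f i - 2 * pi * f j).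
Proof.
have -> : \sum_(i <- r | P i) Complex (s i) 0 * expi2pi (f i) =
    Complex (\sum_(i <- r | P i) s i * cos (2 * pi * f i))
            (\sum_(i <- r | P i) s i * sin (2 * pi * f i)).
  elim: r => [|i r IH]; first by rewrite !big_nil.
  rewrite !big_cons; case: (P i) => //; rewrite IH.
  by apply/eqP; rewrite eq_complex /= !mul0r subr0 addr0 !eqxx.
rewrite /normsq !expr2 !mulr_suml -big_split; apply: eq_bigr => i _ /=.
rewrite !mulr_sumr -big_split; apply: eq_bigr => j _ /=.
by rewrite cosB; ring.
Qed.

Lemma xi_normsqE h x eta : xi_normsq h x eta =
  \sum_(y <- assignments (supp h)) \sum_(y' <- assignments (supp h))
    (if same_outcome h x y y' && (inst_cl h x y == eta)
     then interference h x y y' else 0).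
Proof.
rewrite /xi_normsq; under eq_bigr => k _ do rewrite normsq_sum big_mkcond.
rewrite exchange_big; apply: eq_bigr => y _ /=.
case: (eqVneq (inst_cl h x y) eta) => [cE|_] /=; last first.
  by rewrite !big1 // => y' _; rewrite andbF.
(* For fixed [y], only the ket reached by [y] contributes. *)
rewrite (bigD1 (inst_qu h x y)) //= eqxx [X in _ + X]big1 ?addr0; last first.
  by move=> k; rewrite eq_sym => /negbTE ->.
rewrite big_mkcond; apply: eq_bigr => y' _.
by rewrite /same_outcome cE andbT (eq_sym eta) (eq_sym (inst_qu h x y)).
Qed.

Lemma xi_normsq_gram h x eta : size eta = size (oCl h) ->
  xi_normsq h x eta = gram h x eta.
Proof.
move=> se; rewrite xi_normsqE; apply: eq_bigr => y _; apply: eq_bigr => y' _.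
by rewrite /gram_kernel prefixE se -(size_inst_cl h x y) take_size.
Qed.

Lemma sum_xi_normsq_gram h x eta :
  \sum_(t : (size (oCl h)).-tuple (clentry CA) | prefix eta t) xi_normsq h x t
  = gram h x eta.
Proof.
under eq_bigr => t _ do rewrite xi_normsqE.
rewrite exchange_big; apply: eq_bigr => y _ /=.
rewrite exchange_big; apply: eq_bigr => y' _ /=.
have sy : size (inst_cl h x y) == size (oCl h) by rewrite size_inst_cl.
(* A path has a single history, so only the tuple made of the history of [y] contributes. *)
rewrite big_mkcond (bigD1 (Tuple sy)) //= eqxx andbT big1 ?addr0; last first.
  move=> t tE; case: ifP => // _; case: eqP => [cE|]; last by rewrite andbF.
  by case/eqP: tE; apply: val_inj.
by rewrite /gram_kernel; case: (prefix _ _); rewrite ?andbT ?andbF.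
Qed.

(** * Invariance of the Gram sum under single instructions *)

Lemma eq_gram_kernel h h' x eta y1 y1' y2 y2' :
  same_outcome h x y1 y1' = same_outcome h' x y2 y2' ->
  (same_outcome h' x y2 y2' ->
   prefix eta (inst_cl h x y1) = prefix eta (inst_cl h' x y2) /\
   interference h x y1 y1' = interference h' x y2 y2') ->
  gram_kernel h x eta y1 y1' = gram_kernel h' x eta y2 y2'.
Proof.
rewrite /gram_kernel => -> H; case: ifP => [/andP[E pr]|]; case: ifP => //.
- by case: (H E).
- by rewrite E /=; case: (H E) => <-; rewrite pr.
- by move=> /andP[E pr]; rewrite E; case: (H E) => ->; rewrite pr.
Qed.

(** Prefixes and weights need comparing only on pairs with equal outcomes, because both kernels
    vanish on the others. *)
Lemma eq_gram h h' x eta : supp h = supp h' ->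
  (forall y y', same_outcome h x y y' = same_outcome h' x y y') ->
  (forall y y', same_outcome h' x y y' ->
   prefix eta (inst_cl h x y) = prefix eta (inst_cl h' x y) /\
   interference h x y y' = interference h' x y y') ->
  gram h x eta = gram h' x eta.
Proof.
move=> sE oE kE; rewrite /gram sE; apply: eq_bigr => y _; apply: eq_bigr => y' _.
by apply: eq_gram_kernel => // /kE.
Qed.

Lemma gram_kernel_local h x eta y1 y1' y2 y2' : hps_local h ->
  {in supp h, y1 =1 y2} -> {in supp h, y1' =1 y2'} ->
  gram_kernel h x eta y1 y1' = gram_kernel h x eta y2 y2'.
Proof.
move=> lh /(lh x) [q1 c1 p1 s1] /(lh x) [q2 c2 p2 s2].
by rewrite /gram_kernel /same_outcome /interference q1 q2 c1 c2 p1 p2 s1 s2.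
Qed.

(** The hypothesis says that the new content of [q] separates the same pairs of paths as the old
    entry. It holds for initialisation and for the negation of an allocated bit. *)
Lemma gram_set_qu h q (a : bpoly) x eta :
  (forall y y', Some (a x y) = Some (a x y') <->
     inst_qu h x y q = inst_qu h x y' q) ->
  gram (set_qu h q a) x eta = gram h x eta.
Proof.
move=> aE; apply: eq_gram => // y y'; rewrite /same_outcome; congr (_ && _).
rewrite !inst_qu_set; apply/eqP/eqP => /ffunP E; apply/ffunP => r.
  have := E r; have := E q; rewrite !ffunE eqxx; case: (eqVneq r q) => [->|//].
  by move=> /aE; rewrite !ffunE.
by rewrite [LHS]ffunE [RHS]ffunE (E r); case: eqP => // _; apply/aE; rewrite E.
Qed.

(** An entry determined by the outcome cannot separate paths further, and [eta] ends below the
    pushed entry. A measurement fits this scheme because the measured bit is already part of the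
    ket. *)
Lemma gram_push h (m : CA -> bpoly) x eta : (size eta <= size (oCl h))%N ->
  (forall y y', same_outcome h x y y' -> forall c, m c x y = m c x y') ->
  gram (push h m) x eta = gram h x eta.
Proof.
move=> se mE; apply: eq_gram => // y y'.
  rewrite /same_outcome !inst_cl_push eqseq_rcons.
  case: (boolP (same_outcome h x y y')) => [E|]; rewrite -/(same_outcome h x y y').
    have /andP[/eqP -> /eqP qE] := E; rewrite eqxx /=.
    have -> : [ffun c => m c x y] = [ffun c => m c x y'] :> clentry CA.
      by apply/ffunP => c; rewrite !ffunE (mE _ _ E).
    by rewrite eqxx -[inst_qu (push h m)]/(inst_qu h) qE eqxx.
  rewrite /same_outcome -[inst_qu (push h m)]/(inst_qu h).
  by case: eqP => //= _ /negbTE ->; rewrite andbF.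
move=> _; split=> //.
by rewrite inst_cl_push !prefixE -cats1 takel_cat // size_inst_cl.
Qed.

Lemma gram_phase_gate h k q x eta : gram (sem_gate (GZ k) q h) x eta = gram h x eta.
Proof.
apply: eq_gram => // y y' /andP[_ /eqP qE]; split=> //.
(* Equal kets give equal bits at [q], so both phases shift by the same amount. *)
by rewrite /interference /= !curE qE; congr (_ * cos _); ring.
Qed.

(** Equal new kets force equal values of the fresh variable but forget the old bit of [q]. Summing
    over that value averages the old cosine with one shifted by [pi] times the difference of the old
    bits. The average is the old cosine if the bits agree, and zero otherwise since
    [cos (t + pi) = - cos t]. *)
Lemma gram_hadamard h q x eta : hps_local h -> oQu h q <> None ->
  gram (sem_gate GH q h) x eta = gram h x eta.
Proof.
move=> lh hq; set h' := sem_gate GH q h; set v := fresh (supp h).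
have vE : supp h' = v :: supp h by [].
have vh : v \notin supp h := fresh_notin _.
(* The kernel with the fresh values made explicit: kets are compared away from [q], and the division
   by 2 comes from the two scalars [1 / sqrt 2]. *)
have kE y y' a a' : gram_kernel h' x eta (upd_val y v a) (upd_val y' v a') =
    if [&& a == a', inst_cl h x y == inst_cl h x y',
        [forall r, (r != q) ==> (inst_qu h x y r == inst_qu h x y' r)]
      & prefix eta (inst_cl h x y)]
    then scal h x y * scal h x y' / 2 *
      cos (2 * pi * (phase h x y + b2R R (a && cur h q x y) / 2) -
           2 * pi * (phase h x y' + b2R R (a' && cur h q x y') / 2))
    else 0.
  have [q1 c1 p1 s1] := lh x _ _ (upd_val_agree y a vh).
  have [q2 c2 p2 s2] := lh x _ _ (upd_val_agree y' a' vh).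
  have -> : gram_kernel h' x eta (upd_val y v a) (upd_val y' v a') =
     if [&& inst_cl h x y == inst_cl h x y', a == a' &
        [forall r, (r != q) ==> (inst_qu h x y r == inst_qu h x y' r)]]
        && prefix eta (inst_cl h x y)
     then interference h' x (upd_val y v a) (upd_val y' v a') else 0.
    rewrite /gram_kernel /same_outcome.
    rewrite -[inst_cl h' x (upd_val y v a)]/(inst_cl h x (upd_val y v a)).
    rewrite -[inst_cl h' x (upd_val y' v a')]/(inst_cl h x (upd_val y' v a')).
    rewrite c1 c2 !inst_qu_hadamard -/v q1 q2 !upd_val_same.
    congr (if (_ && _) && _ then _ else _).
    apply/eqP/andP => [/ffunP E|[/eqP -> /forallP E]].
      split; first by have := E q; rewrite !ffunE eqxx => -[->].
      apply/forallP => r; apply/implyP => /negbTE rq.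
      by have := E r; rewrite !(ffunE, rq) => ->.
    apply/ffunP => r; rewrite [LHS]ffunE [RHS]ffunE; case: eqP => // /eqP rq.
    by apply/eqP; have /implyP := E r; apply.
  rewrite andbA [_ && (a == a')]andbC -!andbA; case: ifP => // _.
  rewrite /interference /= -/v s1 s2 p1 p2 !upd_val_same !curE q1 q2; congr (_ * _).
  have s22 : Num.sqrt 2 * Num.sqrt 2 = 2 :> R by rewrite -expr2 sqr_sqrtr.
  by rewrite mulf_div s22.
rewrite /gram vE /assignments /= (negbTE vh).
rewrite -[X in vals X]/(v :: undup (supp h)) sum_vals_cons; apply: eq_bigr => y _.
rewrite !sum_vals_cons -big_split; apply: eq_bigr => y' _ /=; rewrite !kE /=.
rewrite /gram_kernel /same_outcome.
case: (inst_cl h x y == _) => /=; last by rewrite !addr0.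
case: (prefix _ _); rewrite ?andbF ?andbT; last by rewrite !addr0.
set off := [forall r, _].
(* The old kets agree when they agree off [q] and at [q]; allocation of [q] turns its bit back into
   its ket entry. *)
have -> : (inst_qu h x y == inst_qu h x y') = off && (cur h q x y == cur h q x y').
  rewrite !curE; rewrite /off; apply/eqP/andP => [->|[/forallP offE /eqP qE]].
    by split=> //; apply/forallP => r; apply/implyP.
  apply/ffunP => r; case: (eqVneq r q) => [->|rq].
    by rewrite !inst_qu_some // qE.
  by apply/eqP; have /implyP := offE r; apply.
case: off => /=; last by rewrite !addr0.
rewrite /interference !mul0r !addr0 add0r.
(* A phase of 1/2 is an angle of [pi]; the variants cover a first, second or both bits equal to
   1. *)
have shift (t u : R) : 2 * pi * (t + 1 / 2) - 2 * pi * u = 2 * pi * t - 2 * pi * u + pi.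
  by field.
have shift' (t u : R) : 2 * pi * u - 2 * pi * (t + 1 / 2) = - (2 * pi * t - 2 * pi * u + pi).
  by field.
have shift2 (t u : R) :
    2 * pi * (t + 1 / 2) - 2 * pi * (u + 1 / 2) = 2 * pi * t - 2 * pi * u by field.
case: (cur h q x y); case: (cur h q x y'); rewrite /b2R /= ?mul0r ?addr0.
- by rewrite shift2; field.
- by rewrite shift cosDpi; field.
- by rewrite shift' cosN cosDpi -cosN opprB; field.
- by field.
Qed.

(** * Conditionals *)

Lemma gram_split b h x eta :
  gram (bmul (beval b h) h) x eta + gram (bmulC (beval b h) h) x eta = gram h x eta.
Proof.
rewrite /gram -big_split; apply: eq_bigr => y _ /=.
rewrite -big_split; apply: eq_bigr => y' _ /=; rewrite /gram_kernel.
rewrite -[same_outcome (bmul _ _)]/(same_outcome h) -[inst_cl (bmul _ _)]/(inst_cl h).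
rewrite -[same_outcome (bmulC _ _)]/(same_outcome h) -[inst_cl (bmulC _ _)]/(inst_cl h).
case: ifP => [/andP[/andP[/eqP cE /eqP qE] _]|]; last by rewrite addr0.
(* Equal outcomes give equal guard values, so one summand is the old weight and the other is
   zero. *)
rewrite /interference /= !bevalE cE qE; case: (bval _ _ _); rewrite /b2R /=; ring.
Qed.

(** Moves a Gram sum to a larger support. The factors are those that [boxplus] puts on the scalars,
    once for each path of the pair. *)
Lemma gram_pinned h x eta (su : seq nat) : hps_local h ->
  uniq su -> {subset supp h <= su} ->
  \sum_(y <- vals su) \sum_(y' <- vals su)
    gram_kernel h x eta y y'
    * \prod_(w <- su | w \notin supp h) (y w : nat)%:R
    * \prod_(w <- su | w \notin supp h) (y' w : nat)%:R
  = gram h x eta.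
Proof.
move=> lh us hs.
have sE : perm_eq [seq w <- su | w \in supp h] (undup (supp h)).
  apply: uniq_perm; rewrite ?filter_uniq ?undup_uniq // => w.
  by rewrite mem_filter mem_undup; case: (boolP (w \in supp h)) => // /hs ->.
have sumE (F : pval -> R) :
    (forall y y' : pval, {in supp h, y =1 y'} -> F y = F y') ->
    \sum_(y <- vals su) F y * \prod_(w <- su | w \notin supp h) (y w : nat)%:R
    = \sum_(y <- assignments (supp h)) F y.
  by move=> Fl; rewrite sum_vals_pinned // (sum_vals_perm _ _ sE) ?filter_uniq.
rewrite /gram -sumE; last first.
  by move=> y1 y2 y12; apply: eq_bigr => y' _; apply: gram_kernel_local.
apply: eq_bigr => y _; rewrite -sumE; last first.
  by move=> y1 y2 y12; apply: gram_kernel_local.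
by rewrite mulr_suml; apply: eq_bigr => y' _; rewrite mulrAC.
Qed.

(** Equal allocation excludes the fallback clause of [boxplus], which ignores the branch
    variable. *)
Lemma inst_qu_boxplus_alloc h1 h2 x y :
  (forall q, isSome (oQu h1 q) = isSome (oQu h2 q)) ->
  inst_qu (boxplus h1 h2) x y =
  if y (branch_var h1 h2) then inst_qu h2 x y else inst_qu h1 x y.
Proof.
move=> dom; apply/ffunP => q; rewrite inst_qu_boxplus.
have : isSome (inst_qu h1 x y q) = isSome (inst_qu h2 x y q).
  by rewrite !ffunE; move: (dom q); case: (oQu h1 q); case: (oQu h2 q).
by case: (y _); case: (inst_qu h1 x y q) => [?|]; case: (inst_qu h2 x y q).
Qed.

Lemma pad_history_inj n (s t : history CA) : size s = size t ->
  (pad_history n s == pad_history n t) = (s == t).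
Proof.
move=> st; rewrite /pad_history eqseq_cat // st.
by case: (eqVneq s t) => // ->; rewrite eqxx.
Qed.

(** Reconciles the product over the support of the other branch, as in [boxplus], with the product
    over the union, as in [gram_pinned]. *)
Lemma prod_undup_notin (s s' t : seq nat) (F : nat -> R) :
  (forall w, w \notin t -> (w \in s) = (w \in s')) ->
  \prod_(w <- undup s | w \notin t) F w = \prod_(w <- undup s' | w \notin t) F w.
Proof.
move=> ss'; rewrite -[LHS]big_filter -[RHS]big_filter; apply: perm_big.
apply: uniq_perm; rewrite ?filter_uniq ?undup_uniq // => w.
by rewrite !mem_filter !mem_undup; case: (boolP (w \in t)) => // /ss' ->.
Qed.

Lemma gram_kernel_boxplus h1 h2 x eta y y' :
  (forall q, isSome (oQu h1 q) = isSome (oQu h2 q)) ->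
  (size eta <= size (oCl h1))%N -> (size eta <= size (oCl h2))%N ->
  y (branch_var h1 h2) = y' (branch_var h1 h2) ->
  let su := undup (supp h1 ++ supp h2) in
  let g := if y (branch_var h1 h2) then h2 else h1 in
  gram_kernel (boxplus h1 h2) x eta y y' =
  gram_kernel g x eta y y' * \prod_(w <- su | w \notin supp g) (y w : nat)%:R
                           * \prod_(w <- su | w \notin supp g) (y' w : nat)%:R.
Proof.
move=> dom s1 s2 vE su g; have gE : y' (branch_var h1 h2) = y (branch_var h1 h2) by [].
rewrite /gram_kernel /same_outcome !inst_qu_boxplus_alloc // !inst_cl_boxplus gE.
have clE z : (if y (branch_var h1 h2) then inst_cl h2 x z else inst_cl h1 x z)
    = inst_cl g x z by rewrite /g; case: ifP.
have quE z : (if y (branch_var h1 h2) then inst_qu h2 x z else inst_qu h1 x z)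
    = inst_qu g x z by rewrite /g; case: ifP.
rewrite !clE !quE pad_history_inj ?size_inst_cl //.
(* [eta] is no longer than the unpadded history, so padding cannot affect the test. *)
have -> n : prefix eta (pad_history n (inst_cl g x y)) = prefix eta (inst_cl g x y).
  by rewrite !prefixE takel_cat // size_inst_cl /g; case: ifP.
case: ifP => _; last by rewrite !mul0r.
have phE z : z (branch_var h1 h2) = y (branch_var h1 h2) ->
    phase (boxplus h1 h2) x z = phase g x z.
  by move=> zE; rewrite /= -/(branch_var h1 h2) zE /g; case: ifP.
have scE z : z (branch_var h1 h2) = y (branch_var h1 h2) ->
    scal (boxplus h1 h2) x z =
    scal g x z * \prod_(w <- su | w \notin supp g) (z w : nat)%:R.
  move=> zE; rewrite /= -/(branch_var h1 h2) zE /g /su.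
  by case: ifP => _; congr (_ * _); apply: prod_undup_notin => w /negbTE wn;
    rewrite mem_cat wn ?orbF.
by rewrite /interference !phE // !scE //; ring.
Qed.

(** Splitting off the branch variable in both paths gives four sums. The two mixed ones vanish by
    the last hypothesis; the others are the Gram sums of the branches, on the common support. *)
Lemma gram_boxplus h1 h2 x eta :
  hps_local h1 -> hps_local h2 ->
  (forall q, isSome (oQu h1 q) = isSome (oQu h2 q)) ->
  (size eta <= size (oCl h1))%N -> (size eta <= size (oCl h2))%N ->
  (forall y y', same_outcome (boxplus h1 h2) x y y' ->
     y (branch_var h1 h2) != y' (branch_var h1 h2) ->
     interference (boxplus h1 h2) x y y' = 0) ->
  gram (boxplus h1 h2) x eta = gram h1 x eta + gram h2 x eta.
Proof.
move=> l1 l2 dom s1 s2 cross; set v := branch_var h1 h2.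
set su := undup (supp h1 ++ supp h2); have us : uniq su by apply: undup_uniq.
have sub1 : {subset supp h1 <= su} by move=> w w1; rewrite mem_undup mem_cat w1.
have sub2 : {subset supp h2 <= su} by move=> w w2; rewrite mem_undup mem_cat w2 orbT.
have vs : v \notin su := fresh_notin _.
have kernel0 y y' a : gram_kernel (boxplus h1 h2) x eta (upd_val y v a) (upd_val y' v (~~ a)) = 0.
  rewrite /gram_kernel; case: ifP => // /andP[/cross -> //].
  by rewrite !upd_val_same; case: a.
have prodE (t : seq nat) y a : \prod_(w <- su | w \notin t) (upd_val y v a w : nat)%:R
    = \prod_(w <- su | w \notin t) (y w : nat)%:R :> R.
  rewrite big_seq_cond [RHS]big_seq_cond; apply: eq_bigr => w /andP[ws _].
  by rewrite (upd_val_agree _ _ vs ws).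
have agree (t : seq nat) : {subset t <= su} ->
    forall y a, {in t, upd_val y v a =1 y}.
  by move=> ts y a w /ts ws; rewrite (upd_val_agree _ _ vs ws).
rewrite -(gram_pinned x eta l1 us sub1) -(gram_pinned x eta l2 us sub2).
have uE : undup (supp (boxplus h1 h2)) = v :: su.
  by rewrite /= -/su -/(branch_var h1 h2) -/v (negbTE vs) undup_id.
rewrite /gram /assignments uE sum_vals_cons -big_split; apply: eq_bigr => y _ /=.
rewrite !sum_vals_cons -!big_split; apply: eq_bigr => y' _ /=.
rewrite (kernel0 y y' false) (kernel0 y y' true) addr0 add0r.
rewrite !gram_kernel_boxplus // -/v ?upd_val_same //= !prodE.
by rewrite !(gram_kernel_local _ _ l1 (agree _ sub1 _ _) (agree _ sub1 _ _))
  !(gram_kernel_local _ _ l2 (agree _ sub2 _ _) (agree _ sub2 _ _)).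
Qed.

Lemma branch_disjoint b p1 p2 h x :
  let hb := boxplus (sem p1 (bmul (beval b h) h)) (sem p2 (bmulC (beval b h) h)) in
  let v := branch_var (sem p1 (bmul (beval b h) h)) (sem p2 (bmulC (beval b h) h)) in
  (forall q, isSome (oQu (sem p1 (bmul (beval b h) h)) q) =
             isSome (oQu (sem p2 (bmulC (beval b h) h)) q)) ->
  {in qregs_b b, forall q, q \notin qregs p1 ++ qregs p2} ->
  forall y y', same_outcome hb x y y' -> y v != y' v -> interference hb x y y' = 0.
Proof.
move=> hb v dom disj y y' E vE.
(* The branch variable is true on the else branch, whose scalar carries the negated guard; hence the
   negation. *)
have scalE z : scal hb x z = 0 \/ beval b h x z = ~~ z v.
  rewrite /hb /= -/v; case: (boolP (z v)) => _; case: (boolP (beval b h x z)) => bz.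
  - by left; rewrite scal_sem_eq0 ?mul0r //= bz subrr mul0r.
  - by right.
  - by right.
  - by left; rewrite scal_sem_eq0 ?mul0r //= (negbTE bz) mul0r.
(* Truncation recovers the history at the time of the test, since the branches and the padding only
   append. *)
have clE z : take (size (oCl h)) (inst_cl hb x z) = inst_cl h x z.
  apply/eqP; rewrite -{1}(size_inst_cl h x z) -prefixE inst_cl_boxplus prefix_catl //.
  by case: ifP => _;
    [exact: (inst_cl_sem_prefix p2 (bmulC _ h))|exact: (inst_cl_sem_prefix p1 (bmul _ h))].
have quE z : {in qregs_b b, inst_qu hb x z =1 inst_qu h x z}.
  move=> q /disj; rewrite mem_cat negb_or => /andP[q1 q2].
  by rewrite inst_qu_boxplus_alloc //; case: ifP => _; rewrite inst_qu_sem.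
have bE : beval b h x y = beval b h x y'.
  have /andP[/eqP cE /eqP qE] := E.
  rewrite !bevalE -!clE cE; apply: eq_bval => q qb.
  by rewrite -!quE // qE.
rewrite /interference; have [->|yE] := scalE y; first by rewrite !mul0r.
have [->|y'E] := scalE y'; first by rewrite mulr0 mul0r.
(* If both paths obey the guard, they take the same branch, against [vE]. *)
by move: vE; rewrite -[y v]negbK -yE bE y'E negbK eqxx.
Qed.

(** The height condition is an inequality so that the induction can continue from states whose stack
    has grown beyond [eta]. *)
Lemma gram_sem p h x eta : hps_local h -> wf p h -> (size eta <= size (oCl h))%N ->
  gram (sem p h) x eta = gram h x eta.
Proof.
elim: p h => [|q|g q|q c|c1 f c2|p1 IH1 p2 IH2|i j body IH|b p1 IH1 p2 IH2] h lh //=.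
(* The register is absent before [Init] and constant after it, so it never separates two paths. *)
- by move=> hq _; apply: gram_set_qu => y y'; rewrite !inst_qu_none.
- case: g => [||k] hq _; first exact: gram_hadamard.
    apply: gram_set_qu => y y'; rewrite !inst_qu_some // !curE.
    by split=> -[/(congr1 negb)]; rewrite ?negbK => ->.
  exact: gram_phase_gate.
- move=> _ se; apply: gram_push => // y y' /andP[/eqP cE /eqP qE] c'.
  by case: ifP => _; rewrite ?curE ?topClE ?qE ?cE.
- move=> _ se; apply: gram_push => // y y' /andP[/eqP cE _] c'.
  by case: ifP => _; rewrite !topClE cE.
- move=> [w1 w2] se; rewrite IH2 ?IH1 //; first exact: hps_local_sem.
  exact: leq_trans se (size_oCl_sem _ _).
- elim: (for_range i j) h lh => //= k ks IHks h lh [wk wks] se.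
  rewrite IHks ?IH //; first exact: hps_local_sem.
  exact: leq_trans se (size_oCl_sem _ _).
- move=> [guard w1 w2 dom] se.
  have l1 : hps_local (bmul (beval b h) h) by exact: hps_local_bmul.
  have l2 : hps_local (bmulC (beval b h) h) by exact: hps_local_bmulC.
  rewrite gram_boxplus ?IH1 ?IH2 ?gram_split //.
  + exact: hps_local_sem.
  + exact: hps_local_sem.
  + exact: leq_trans se (size_oCl_sem p1 (bmul _ h)).
  + exact: leq_trans se (size_oCl_sem p2 (bmulC _ h)).
  + apply: branch_disjoint => // q qb.
    (* A classical guard reads no quantum register; a quantum one shares none with the branches. *)
    case: guard => [qs0|[_ _ /allP disj _]]; first by rewrite qs0 in qb.
    by apply/negP => /disj; rewrite qb.
Qed.

End Gram.

Theorem mainTheorem4 (R : realType) (QA CA : finType)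
    (p : prog QA CA) (h : hps R QA CA) (x : ival) (eta : history CA) :
  hps_wf h -> wf p h -> size eta = size (oCl h) ->
  xi_normsq h x eta =
  \sum_(t : (size (oCl (sem p h))).-tuple (clentry CA) | prefix eta t)
     xi_normsq (sem p h) x t.
Proof.
move=> /hps_wf_local lh wp se.
by rewrite sum_xi_normsq_gram xi_normsq_gram // gram_sem // se.
Qed.
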